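(* A CSP $\langle x \cdot y = z \ ;\ x \in D_x, y \in D_y, z \in D_z\rangle$, where $D_x, D_y, D_z$ are non-empty integer intervals, is closed under the applications of the MULTIPLICATION 1, 2 and 3 rules if and only if it is closed under the applications of the MULTIPLICATION 1, 2w and 3w rules.
   Context: An integer interval is a set $[l..h] = \{x \in \mathbb{Z} \mid l \le x \le h\}$ with $l,h$ integers (empty if $l > h$). The constraint satisfaction problem (CSP) $\langle x \cdot y = z \ ;\ x \in D_x, y \in D_y, z \in D_z\rangle$ consists of the variables $x,y,z$ with respective domains $D_x, D_y, D_z$ and the single constraint $x \cdot y = z$. For sets of integers $X, Y$: $X \cdot Y := \{x \cdot y \mid x \in X, y \in Y\}$ and $X/Y := \{u \in \mathbb{Z} \mid \exists x \in X\ \exists y \in Y\ u \cdot y = x\}$. For a set of integers $X$, $\operatorname{int}(X)$ is the smallest integer interval containing $X$ if $X$ is finite, and $\mathbb{Z}$ otherwise. Weak division of non-empty integer intervals $[a..b]$ and $[c..d]$: $$[a..b] : [c..d] := \begin{cases} [\lceil \min(A) \rceil .. \lfloor \max(A) \rfloor] & \text{if } 0 \notin [c..d], \text{ or } \big(0 \notin [a..b] \text{ and } 0 \in \{c,d\} \text{ and } c < d\big),\\ [a..b] / [c..d] & \text{otherwise,}\end{cases}$$ where $A = \{a/c', a/d', b/c', b/d'\}$ (real quotients) and $[c'..d']$ is the integer interval obtained from $[c..d]$ by removing the element $0$ (so $[c'..d'] = [c..d]$ if $0 \notin [c..d]$). The rules transform the CSP $\langle x \cdot y = z \ ;\ x \in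 D_x, y \in D_y, z \in D_z\rangle$ as follows: - MULTIPLICATION 1 replaces $D_z$ by $D_z \cap \operatorname{int}(D_x \cdot D_y)$; - MULTIPLICATION 2 replaces $D_x$ by $D_x \cap \operatorname{int}(D_z / D_y)$; - MULTIPLICATION 3 replaces $D_y$ by $D_y \cap \operatorname{int}(D_z / D_x)$; - MULTIPLICATION 2w replaces $D_x$ by $D_x \cap \operatorname{int}(D_z : D_y)$; - MULTIPLICATION 3w replaces $D_y$ by $D_y \cap \operatorname{int}(D_z : D_x)$. A CSP is closed under the applications of a rule if applying the rule leaves all domains unchanged. *)

(* Defs.v *)
From mathcomp Require Import all_boot all_order all_algebra.
From mathcomp Require Import mathcomp_extra boolp classical_sets cardinality.
From mathcomp Require Import set_interval.
From mathcomp Require Import zify.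

Set Implicit Arguments.
Unset Strict Implicit.
Unset Printing Implicit Defensive.

Import Order.TTheory GRing.Theory Num.Theory.
Local Open Scope classical_set_scope.
Local Open Scope ring_scope.

Definition int_itv (l h : int) : set int := `[l, h]%classic.

Definition is_int_itv (X : set int) : Prop :=
  exists l h : int, X = int_itv l h.

Definition set_mul (X Y : set int) : set int :=
  [set x * y | x in X & y in Y].

(* Here 0 may belong to Y: 0 \in X and 0 \in Y give set_div X Y = Z. *)
Definition set_div (X Y : set int) : set int :=
  [set u | exists2 x, X x & exists2 y, Y y & u * y = x].

(* [smallest] is the intersection of all the integer intervals containing X;
   for finite X it is itself an integer interval, see [int_hull_itv]. *)
Definition int_hull (X : set int) : set int :=
  if `[< finite_set X >] then smallest is_int_itv X else setT.

(* The bounds c', d' of [c..d] deprived of 0. They are used only if 0 is not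
   in [c..d], or if 0 is an endpoint and c < d, see [int_itvD0]. *)
Definition lo_nz (c : int) : int := if c == 0 then 1 else c.
Definition hi_nz (d : int) : int := if d == 0 then - 1 else d.

(* The quotients of integers are taken exactly, in rat. *)
Definition quot (a c : int) : rat := a%:~R / c%:~R.

Definition min4 (p q r s : rat) : rat := Num.min (Num.min p q) (Num.min r s).
Definition max4 (p q r s : rat) : rat := Num.max (Num.max p q) (Num.max r s).

Definition quot_itv (a b c d : int) : set int :=
  int_itv (Num.ceil (min4 (quot a c) (quot a d) (quot b c) (quot b d)))
          (Num.floor (max4 (quot a c) (quot a d) (quot b c) (quot b d))).

Definition weak_div_cond (a b c d : int) : Prop :=
  ~ int_itv c d 0 \/
  [/\ ~ int_itv a b 0, c = 0 \/ d = 0 & c < d].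

Definition weak_div_itv (a b c d : int) : set int :=
  if `[< weak_div_cond a b c d >] then quot_itv a b (lo_nz c) (hi_nz d)
  else set_div (int_itv a b) (int_itv c d).

(* Weak division is meaningful for non-empty integer intervals, whose endpoints
   are unique, see [weak_divE]; it takes the dummy value set0 elsewhere. *)
Definition weak_div (X Y : set int) : set int :=
  [set u | exists a b c d : int,
     [/\ a <= b, c <= d, X = int_itv a b, Y = int_itv c d
       & weak_div_itv a b c d u]].

(* The CSP < x * y = z ; x \in Dx, y \in Dy, z \in Dz >. *)
Record mul_csp := MulCSP { Dx : set int; Dy : set int; Dz : set int }.

Definition mul_rule := mul_csp -> mul_csp.

Definition mul1 : mul_rule := fun P =>
  MulCSP (Dx P) (Dy P) (Dz P `&` int_hull (set_mul (Dx P) (Dy P))).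
Definition mul2 : mul_rule := fun P =>
  MulCSP (Dx P `&` int_hull (set_div (Dz P) (Dy P))) (Dy P) (Dz P).
Definition mul3 : mul_rule := fun P =>
  MulCSP (Dx P) (Dy P `&` int_hull (set_div (Dz P) (Dx P))) (Dz P).
Definition mul2w : mul_rule := fun P =>
  MulCSP (Dx P `&` int_hull (weak_div (Dz P) (Dy P))) (Dy P) (Dz P).
Definition mul3w : mul_rule := fun P =>
  MulCSP (Dx P) (Dy P `&` int_hull (weak_div (Dz P) (Dx P))) (Dz P).

Definition closed_under (r : mul_rule) (P : mul_csp) : Prop := r P = P.

Definition nonempty_itv (X : set int) : Prop := is_int_itv X /\ X !=set0.

Lemma int_itvP (l h x : int) : int_itv l h x <-> l <= x <= h.
Proof. by rewrite /int_itv /= in_itv. Qed.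

Lemma int_itv_inj (a b c d : int) :
  a <= b -> c <= d -> int_itv a b = int_itv c d -> a = c /\ b = d.
Proof.
move=> ab cd E.
have /int_itvP/andP[ca _] : int_itv c d a by rewrite -E; apply/int_itvP/andP.
have /int_itvP/andP[_ bd] : int_itv c d b by rewrite -E; apply/int_itvP/andP.
have /int_itvP/andP[ac _] : int_itv a b c by rewrite E; apply/int_itvP/andP.
have /int_itvP/andP[_ db] : int_itv a b d by rewrite E; apply/int_itvP/andP.
by split; apply/eqP; rewrite eq_le; apply/andP.
Qed.

Lemma weak_divE (a b c d : int) : a <= b -> c <= d ->
  weak_div (int_itv a b) (int_itv c d) = weak_div_itv a b c d.
Proof.
move=> ab cd; apply/seteqP; split=> [u|u Hu]; last by exists a, b, c, d.
move=> [a' [b' [c' [d' [ab' cd' E1 E2 Hu]]]]].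
have [-> ->] := int_itv_inj ab ab' E1.
by have [-> ->] := int_itv_inj cd cd' E2.
Qed.

Lemma int_itvD0 (c d : int) :
  ~ int_itv c d 0 \/ ((c = 0 \/ d = 0) /\ c < d) -> c <= d ->
  int_itv (lo_nz c) (hi_nz d) = int_itv c d `\ 0.
Proof.
move=> H cd; apply/seteqP; split=> x; rewrite /lo_nz /hi_nz.
- move=> /int_itvP xin; suff [? ?] : c <= x <= d /\ x <> 0.
    by split=> //; apply/int_itvP.
  move: H xin; rewrite int_itvP; case: eqP => ?; case: eqP => ?; lia.
- move=> [/int_itvP xin /= x0]; apply/int_itvP.
  by move: H xin; rewrite int_itvP; case: eqP => ?; case: eqP => ?; lia.
Qed.

Lemma int_hull_itv (X : set int) : finite_set X -> is_int_itv (int_hull X).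
Proof.
move=> finX; rewrite /int_hull asboolT//.
suff [Y [YI XY Ymin]] : exists Y, [/\ is_int_itv Y, X `<=` Y &
    forall Z, is_int_itv Z -> X `<=` Z -> Y `<=` Z].
  suff -> : smallest is_int_itv X = Y by [].
  apply/seteqP; split; first exact: smallest_sub.
  by move=> y Yy Z [ZI XZ]; exact: Ymin Yy.
have /finite_seqP[s ->] := finX.
elim: s => [|x s [_ [[l [h ->]] sY Ymin]]].
  exists (int_itv 1 0); split; [by exists 1, 0|by []|].
  by move=> Z _ _ y /int_itvP; lia.
have [lh|hl] := leP l h; last first.
  exists (int_itv x x); split; first by exists x, x.
  - move=> y /=; rewrite inE => /orP[/eqP ->|/sY/int_itvP]; last by lia.
    by apply/int_itvP; lia.
  - move=> Z _ sZ y /int_itvP xy; have -> : y = x by lia.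
    by apply: sZ; rewrite /= mem_head.
exists (int_itv (Num.min x l) (Num.max x h)); split; first by do 2 eexists.
- move=> y /=; rewrite inE => /orP[/eqP ->|/sY/int_itvP yin];
    by apply/int_itvP; lia.
- move=> Z ZI sZ; have lhZ : int_itv l h `<=` Z.
    by apply: Ymin => // y ys; apply: sZ; rewrite /= inE; apply/orP; right.
  have Zx : Z x by apply: sZ; rewrite /= mem_head.
  have Zl : Z l by apply: lhZ; apply/int_itvP; lia.
  have Zh : Z h by apply: lhZ; apply/int_itvP; lia.
  case: ZI Zx Zl Zh => [l' [h' ->]] /int_itvP ? /int_itvP ? /int_itvP ?.
  by move=> y /int_itvP ?; apply/int_itvP; lia.
Qed.

(* Main.v *)
(** Let X = [p..q], Y = [c..d], Z = [a..b]. One direction is rule by rule: an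
    exact quotient lies between the extreme corner quotients, so Z / Y is
    contained in Z : Y. Conversely, Z : Y differs from Z / Y only when 0 is
    not in Y, or when 0 is an endpoint of Y and not in Z. In the second case
    closure under 2w keeps 0 out of X, and then closure under 3w keeps 0 out
    of Y, a contradiction. In the first case the corner inequalities of 2w and
    3w together place in Z, for each endpoint of X, its product with a
    suitable endpoint of Y; e.g. if X, Y > 0 then 2w gives q c <= b and 3w
    gives a <= q c, so that q = (q c) / c is an exact quotient. *)
Require Import Defs.
From mathcomp Require Import all_boot all_order all_algebra.
From mathcomp Require Import mathcomp_extra boolp classical_sets cardinality.
From mathcomp Require Import set_interval.
From mathcomp Require Import zify.

Set Implicit Arguments.
Unset Strict Implicit.
Unset Printing Implicit Defensive.

Import Order.TTheory GRing.Theory Num.Theory.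
Local Open Scope classical_set_scope.
Local Open Scope ring_scope.

Lemma finite_int_itv (l h : int) : finite_set (int_itv l h).
Proof.
apply: (@sub_finite_set _ _ ((fun n : nat => l + n%:Z) @` `I_(`|h - l|.+1))).
  by move=> x /int_itvP xlh; exists `|x - l|%N; rewrite /=; lia.
by apply: finite_image; exact: finite_II.
Qed.

Lemma sub_int_hull (S T : set int) : S `<=` T -> int_hull S `<=` int_hull T.
Proof.
move=> ST; rewrite /int_hull; case: asboolP => [fS|nfS]; case: asboolP => // fT.
  by move=> x Sx I [II TI]; apply: Sx; split=> // y /ST /TI.
by case: nfS; exact: sub_finite_set fT.
Qed.

Lemma int_hull_int_itv (l h : int) : int_hull (int_itv l h) `<=` int_itv l h.
Proof.
rewrite /int_hull asboolT; last exact: finite_int_itv.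
by apply: smallest_sub => //; exists l, h.
Qed.

Lemma between_int_hull (S : set int) (u v x : int) :
  S u -> S v -> u <= x <= v -> int_hull S x.
Proof.
move=> Su Sv uxv; rewrite /int_hull; case: asboolP => // _ I [[l [h ->]] SI].
by move/SI/int_itvP: Su; move/SI/int_itvP: Sv => ? ?; apply/int_itvP; lia.
Qed.

(** Multiplying by [c * c], positive whatever the sign of [c], clears the denominator without a case
    split. *)
Lemma quot_le (a c u : int) : c != 0 ->
  (quot a c <= u%:~R) = (a * c <= u * c * c).
Proof.
move=> c0; rewrite /quot.
have c2 : 0 < (c%:~R * c%:~R : rat) by rewrite -intrM ltr0z; nia.
rewrite -(ler_pM2r c2) mulrA mulfVK ?intr_eq0// -!intrM ler_int.
by rewrite mulrA.
Qed.

Lemma quot_ge (a c u : int) : c != 0 ->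
  (u%:~R <= quot a c) = (u * c * c <= a * c).
Proof.
move=> c0; rewrite /quot.
have c2 : 0 < (c%:~R * c%:~R : rat) by rewrite -intrM ltr0z; nia.
rewrite -(ler_pM2r c2) [leRHS]mulrA mulfVK ?intr_eq0// -!intrM ler_int.
by rewrite mulrA.
Qed.

Lemma quot_itvP (a b c d u : int) : c != 0 -> d != 0 ->
  quot_itv a b c d u <->
  [|| a * c <= u * c * c, a * d <= u * d * d,
      b * c <= u * c * c | b * d <= u * d * d] &&
  [|| u * c * c <= a * c, u * d * d <= a * d,
      u * c * c <= b * c | u * d * d <= b * d].
Proof.
move=> c0 d0; rewrite /quot_itv int_itvP ceil_le_int floor_ge_int.
rewrite /min4 /max4 !ge_min !le_max !quot_le// !quot_ge//.
by rewrite -!orbA.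
Qed.

Lemma quot_itv_gt0 (a b c d u : int) : a <= b -> 0 < c -> c <= d ->
  quot_itv a b c d u <->
  (a <= u * c \/ a <= u * d) /\ (u * c <= b \/ u * d <= b).
Proof.
move=> ab c0 cd.
have d0 : 0 < d by lia.
rewrite quot_itvP ?gt_eqF// !ler_pM2r//; lia.
Qed.

(** Cancelling a negative divisor reverses both bounds, which only swaps the two conjuncts; hence
    the same form as for positive divisors. *)
Lemma quot_itv_lt0 (a b c d u : int) : a <= b -> d < 0 -> c <= d ->
  quot_itv a b c d u <->
  (a <= u * c \/ a <= u * d) /\ (u * c <= b \/ u * d <= b).
Proof.
move=> ab d0 cd.
have c0 : c < 0 by lia.
rewrite quot_itvP ?lt_eqF// !ler_nM2r//; lia.
Qed.

(** The condition excludes [c < 0 < d] and [c = d = 0], so deleting 0 leaves a non-empty interval of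
    constant sign. *)
Lemma nz_bounds (a b c d : int) : a <= b -> c <= d -> weak_div_cond a b c d ->
  [/\ lo_nz c <= hi_nz d, 0 < lo_nz c \/ hi_nz d < 0 &
      forall y, (lo_nz c <= y <= hi_nz d) = (y != 0) && (c <= y <= d)].
Proof.
move=> ab cd; rewrite /weak_div_cond !int_itvP /lo_nz /hi_nz => H.
have {}H : ~ (c <= 0 <= d) \/ (c = 0 \/ d = 0) /\ c < d.
  by case: H => [|[]]; [left|right].
split=> [||y]; case: eqP => c0; case: eqP => d0; lia.
Qed.

Lemma quot_itv_nz (a b c d u : int) : a <= b -> c <= d ->
  weak_div_cond a b c d ->
  quot_itv a b (lo_nz c) (hi_nz d) u <->
  (a <= u * lo_nz c \/ a <= u * hi_nz d) /\
  (u * lo_nz c <= b \/ u * hi_nz d <= b).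
Proof.
move=> ab cd H; have [cd' [c0|d0] _] := nz_bounds ab cd H.
- exact: quot_itv_gt0.
- exact: quot_itv_lt0.
Qed.

Lemma set_div_sub_weak_div (a b c d : int) : a <= b -> c <= d ->
  set_div (int_itv a b) (int_itv c d) `<=`
  weak_div (int_itv a b) (int_itv c d).
Proof.
move=> ab cd; rewrite weak_divE// /weak_div_itv; case: asboolP => H; last exact: subset_refl.
move=> u [x /int_itvP xab [y /int_itvP ycd xE]].
apply/quot_itv_nz => //.
(* If [y = 0] then [x = 0], so 0 lies in both intervals, against either alternative of [H]. *)
have y0 : y != 0.
  apply/eqP=> y0; rewrite -xE y0 mulr0 in xab; rewrite y0 in ycd.
  by case: H => [|[]]; rewrite int_itvP.
have [_ _ /(_ y)] := nz_bounds ab cd H; rewrite y0 ycd => /andP[cy yd].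
(* [u * y] lies between the products of [u] with the two bounds, in an order given by the sign of
   [u]. *)
have [u0|u0] := leP 0 u.
- have := ler_wpM2l u0 cy; have := ler_wpM2l u0 yd; lia.
- have := ler_wnM2l (ltW u0) cy; have := ler_wnM2l (ltW u0) yd; lia.
Qed.

Lemma weak_div_hull (a b c d u : int) : a <= b -> c <= d ->
  weak_div_cond a b c d ->
  int_hull (weak_div (int_itv a b) (int_itv c d)) u ->
  (a <= u * lo_nz c \/ a <= u * hi_nz d) /\
  (u * lo_nz c <= b \/ u * hi_nz d <= b).
Proof.
move=> ab cd H; rewrite weak_divE// /weak_div_itv asboolT//.
by move=> /int_hull_int_itv /quot_itv_nz; exact.
Qed.

Lemma weak_div_hull_nz (a b c d u : int) : a <= b -> c <= d ->
  ~ int_itv c d 0 ->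
  int_hull (weak_div (int_itv a b) (int_itv c d)) u ->
  (a <= u * c \/ a <= u * d) /\ (u * c <= b \/ u * d <= b).
Proof.
move=> ab cd cd0 /(weak_div_hull ab cd (or_introl cd0)).
by move: cd0; rewrite int_itvP /lo_nz /hi_nz; case: eqP; case: eqP; lia.
Qed.

Lemma weak_div_closed_nz (a b c d p q : int) : a <= b -> c <= d -> p <= q ->
  weak_div_cond a b c d ->
  int_itv p q `<=` int_hull (weak_div (int_itv a b) (int_itv c d)) ->
  int_itv c d `<=` int_hull (weak_div (int_itv a b) (int_itv p q)) ->
  ~ int_itv c d 0.
Proof.
move=> ab cd pq H X2 Y3 Y0.
have [//|[Z0 _ _]] := H.
(* At [u = 0] the corner inequalities collapse to [a <= 0 <= b]. *)
have X0 : ~ int_itv p q 0.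
  move=> /X2 /(weak_div_hull ab cd H); rewrite !mul0r => ?.
  by apply: Z0; apply/int_itvP; lia.
have := weak_div_hull_nz ab pq X0 (Y3 _ Y0); rewrite !mul0r => ?.
by apply: Z0; apply/int_itvP; lia.
Qed.

Lemma weak_div_closed_div (a b c d p q : int) : a <= b -> c <= d -> p <= q ->
  int_itv p q `<=` int_hull (weak_div (int_itv a b) (int_itv c d)) ->
  int_itv c d `<=` int_hull (weak_div (int_itv a b) (int_itv p q)) ->
  int_itv p q `<=` int_hull (set_div (int_itv a b) (int_itv c d)).
Proof.
move=> ab cd pq X2 Y3.
have [H|H] := pselect (weak_div_cond a b c d); last first.
  by move: X2; rewrite weak_divE// /weak_div_itv asboolF.
have Y0 := weak_div_closed_nz ab cd pq H X2 Y3.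
have Yc : int_itv c d c by apply/int_itvP; lia.
have Yd : int_itv c d d by apply/int_itvP; lia.
have Xp : int_itv p q p by apply/int_itvP; lia.
have Xq : int_itv p q q by apply/int_itvP; lia.
have Hp := weak_div_hull_nz ab cd Y0 (X2 _ Xp).
have Hq := weak_div_hull_nz ab cd Y0 (X2 _ Xq).
have divE u y : int_itv c d y -> a <= u * y <= b ->
    set_div (int_itv a b) (int_itv c d) u.
  by move=> ycd uy; exists (u * y); [exact/int_itvP|exists y].
(* The hull is convex, so it suffices that both endpoints [p] and [q] are exact quotients. *)
suff [[y ycd yp] [y' ycd' yq]] :
    (exists2 y, int_itv c d y & a <= p * y <= b) /\
    (exists2 y, int_itv c d y & a <= q * y <= b).
  move=> x /int_itvP.
  exact: between_int_hull (divE _ _ ycd yp) (divE _ _ ycd' yq).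
(* If 0 is in X, the endpoint of Y nearest 0 serves both: its products with [p] and [q] lie on
   opposite sides of 0, so the bound that 2w gives on each carries over to the other. *)
have [X0|X0] := pselect (int_itv p q 0).
- move: X0 Y0; rewrite !int_itvP => X0 Y0.
  have [c0|c0] := ltP 0 c.
  + by split; exists c => //; nia.
  + by split; exists d => //; nia.
have Hc := weak_div_hull_nz ab pq X0 (Y3 _ Yc).
have Hd := weak_div_hull_nz ab pq X0 (Y3 _ Yd).
move: X0 Y0; rewrite !int_itvP => X0 Y0.
(* With both signs constant, the endpoint of X nearer 0 is paired with the endpoint of Y farther
   from 0, and conversely; 2w bounds the product on one side, 3w on the other. *)
have [c0|c0] := ltP 0 c; have [p0|p0] := ltP 0 p.
- by split; [exists d|exists c] => //; nia.
- by split; [exists c|exists d] => //; nia.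
- by split; [exists c|exists d] => //; nia.
- by split; [exists d|exists c] => //; nia.
Qed.

Lemma nonempty_itvE (X : set int) : nonempty_itv X ->
  exists l h : int, l <= h /\ X = int_itv l h.
Proof.
by move=> [[l [h ->]] [x /int_itvP xlh]]; exists l, h; split=> //; lia.
Qed.

Theorem theorem10p1 (P : mul_csp)
    (hx : nonempty_itv (Dx P)) (hy : nonempty_itv (Dy P))
    (hz : nonempty_itv (Dz P)) :
  (closed_under mul1 P /\ closed_under mul2 P /\ closed_under mul3 P) <->
  (closed_under mul1 P /\ closed_under mul2w P /\ closed_under mul3w P).
Proof.
case: P hx hy hz => X Y Z /=.
move=> /nonempty_itvE[p [q [pq ->]]] /nonempty_itvE[c [d [cd ->]]].
move=> /nonempty_itvE[a [b [ab ->]]].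
have xE A : closed_under (fun P => MulCSP (Dx P `&` A) (Dy P) (Dz P))
    (MulCSP (int_itv p q) (int_itv c d) (int_itv a b)) <-> int_itv p q `<=` A.
  by rewrite /closed_under /= -setIidPl; split=> [[]|->].
have yE A : closed_under (fun P => MulCSP (Dx P) (Dy P `&` A) (Dz P))
    (MulCSP (int_itv p q) (int_itv c d) (int_itv a b)) <-> int_itv c d `<=` A.
  by rewrite /closed_under /= -setIidPl; split=> [[]|->].
split=> -[h1 [/xE h2 /yE h3]]; split=> //; split.
- by apply/xE => x /h2; apply: sub_int_hull; exact: set_div_sub_weak_div.
- by apply/yE => y /h3; apply: sub_int_hull; exact: set_div_sub_weak_div.
- by apply/xE; exact: weak_div_closed_div.
(* Exchanging X and Y merely exchanges the two inclusions assumed by the lemma. *)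
- by apply/yE; exact: weak_div_closed_div.
Qed.
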